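(* Let $a,b,c,d$ be real numbers such that the four points $(a,0)$, $(b,0)$, $(0,c)$, $(0,d)$ of $\mathbb{R}^2$ are distinct and at least one (nondegenerate) ellipse passes through all four of them. Put $$A=cd,\quad C=ab,\quad D=-\tfrac12 cd(a+b),\quad E=-\tfrac12 ab(c+d),\quad F=abcd.$$ Then the cubic polynomial in $B$ $$FB^3-4DEB^2+(3CD^2+3AE^2-ACF)B-2ACDE$$ has three distinct real roots.
   Context: For each real $B$, the conic $Ax^2+2Bxy+Cy^2+2Dx+2Ey+F=0$ with coefficients $A=cd$, $C=ab$, $D=-\tfrac12 cd(a+b)$, $E=-\tfrac12 ab(c+d)$, $F=abcd$ passes through the four points $(a,0)$, $(b,0)$, $(0,c)$, $(0,d)$; it is an ellipse exactly when $B^2<AC$. The cubic is the numerator (up to a constant factor) of the derivative with respect to $B$ of the area of this ellipse. *)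

(* Defs.v *)
From mathcomp Require Import all_boot all_order all_algebra.
From mathcomp Require Import classical_sets reals.

Set Implicit Arguments.
Unset Strict Implicit.
Unset Printing Implicit Defensive.

Import Order.TTheory GRing.Theory Num.Theory.
Local Open Scope ring_scope.
Local Open Scope classical_set_scope.

(* The locus X^2 / p^2 + Y^2 / q^2 = 1, where (X, Y) are the coordinates of P
   in the orthonormal frame with origin O and axes (u, v), (- v, u). *)
Definition ellipse_locus (R : realType) (O : R * R) (u v p q : R)
    : set (R * R) :=
  [set P | (u * (P.1 - O.1) + v * (P.2 - O.2)) ^+ 2 / p ^+ 2 +
           (- v * (P.1 - O.1) + u * (P.2 - O.2)) ^+ 2 / q ^+ 2 = 1].

(* Positive semi-axes p, q exclude the empty and one-point loci as well as
   lines; circles are allowed (p = q). *)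
Definition is_ellipse (R : realType) (S : set (R * R)) : Prop :=
  exists (O : R * R) (u v p q : R),
    [/\ u ^+ 2 + v ^+ 2 = 1, 0 < p, 0 < q & S = ellipse_locus O u v p q].

(* Main.v *)
(* Dividing the cubic by F = AC and putting s = (a + b)/2, t = (c + d)/2 gives
   the monic cubic g(B) below. Restricting the equation of the ellipse to the
   two coordinate axes yields AC > 0, while a <> b and c <> d give s^2 > C and
   t^2 > A. With k = sqrt (AC), g(k) = 3 k (sqrt A s - sqrt C t)^2 >= 0 and
   g(st) = - 3 st (s^2 - C)(t^2 - A) < 0 when A, C > 0 and st > 0; for
   A, C < 0 and st > 0 one uses g(-k) >= 0 > g(0) instead. Such a drop of a
   monic cubic, with g' <> 0 in the case g(k) = 0, forces three distinct
   roots. *)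
Require Import Defs.
From mathcomp Require Import all_boot all_order all_algebra.
From mathcomp Require Import classical_sets reals.
From mathcomp Require Import ring lra.

Set Implicit Arguments.
Unset Strict Implicit.
Unset Printing Implicit Defensive.

Import Order.TTheory GRing.Theory Num.Theory.
Local Open Scope ring_scope.

(** * Real roots of monic cubics *)

Lemma monic_cubic_root_gt (R : rcfType) (p q m y : R) :
  y ^+ 3 + p * y ^+ 2 + q * y + m < 0 ->
  exists2 r, y < r & r ^+ 3 + p * r ^+ 2 + q * r + m = 0.
Proof.
move=> gy.
pose P : {poly R} := 'X^3 + p *: 'X^2 + q *: 'X + m%:P.
have PE x : P.[x] = x ^+ 3 + p * x ^+ 2 + q * x + m.
  by rewrite /P !(hornerD, hornerZ, hornerXn, hornerX, hornerC).
(* [M] lies above [y], and [M >= 1] turns the lower-order terms at [M] into multiples of [M ^+ 2],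
   which [M ^+ 3] dominates because [M] exceeds the sum of the absolute values of [p], [q] and [m].
   The intermediate value theorem then applies between [y] and [M]. *)
pose M := 1 + `|p| + `|q| + `|m| + `|y|.
have [p0 q0 m0 y0] : [/\ 0 <= `|p|, 0 <= `|q|, 0 <= `|m| & 0 <= `|y|] by [].
have [pl ql ml yl] : [/\ - `|p| <= p, - `|q| <= q, - `|m| <= m & y <= `|y|].
  by split; rewrite ?ler_norm // lerNl ler_normr lexx orbT.
have M1 : 1 <= M by rewrite /M; lra.
have yM : y <= M by rewrite /M; lra.
have gM : 0 <= P.[M].
  rewrite PE.
  have M2 : M <= M ^+ 2 by rewrite expr2; nra.
  have h1 : 0 <= (p + `|p|) * M ^+ 2 by apply: mulr_ge0; rewrite ?sqr_ge0 //; lra.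
  have h2 : 0 <= (q + `|q|) * M by apply: mulr_ge0; lra.
  have h3 : 0 <= `|q| * (M ^+ 2 - M) by apply: mulr_ge0; lra.
  have h4 : 0 <= `|m| * (M ^+ 2 - 1) by apply: mulr_ge0; lra.
  have h5 : 0 <= (M - `|p| - `|q| - `|m|) * M ^+ 2.
    by apply: mulr_ge0; rewrite ?sqr_ge0 //; rewrite /M; lra.
  have -> : M ^+ 3 + p * M ^+ 2 + q * M + m =
    (M - `|p| - `|q| - `|m|) * M ^+ 2 + (p + `|p|) * M ^+ 2 + (q + `|q|) * M
    + `|q| * (M ^+ 2 - M) + `|m| * (M ^+ 2 - 1) + (m + `|m|) by ring.
  lra.
have gyM : P.[y] <= 0 <= P.[M] by rewrite gM PE ltW.
have [r /andP[yr _] /eqP Pr] := poly_ivt yM gyM.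
rewrite PE in Pr; exists r => //.
rewrite lt_neqAle yr andbT.
by apply/eqP => y_r; move: gy; rewrite y_r Pr ltxx.
Qed.

(** Dividing out a root [r > y] leaves a monic quadratic that is [<= 0] at [x] and positive at [y],
    since [x < y < r]. Its roots are therefore real. They could coincide only at [x], where the
    derivative of [g] would then vanish; the last hypothesis excludes this. *)
Lemma monic_cubic_roots (R : rcfType) (p q m x y : R)
    (g := fun z => z ^+ 3 + p * z ^+ 2 + q * z + m) :
  x < y -> 0 <= g x -> g y < 0 ->
  (g x = 0 -> 3 * x ^+ 2 + 2 * p * x + q != 0) ->
  exists r1 r2 r3,
    [/\ uniq [:: r1; r2; r3], g r1 = 0, g r2 = 0 & g r3 = 0].
Proof.
rewrite /g => xy gx gy dg.
have [r yr gr] := monic_cubic_root_gt gy.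
(* g = (X - r) (X^2 + u X + w) *)
pose u := p + r; pose w := q + r * u.
have gE z : z ^+ 3 + p * z ^+ 2 + q * z + m =
    (z - r) * (z ^+ 2 + u * z + w).
  rewrite -[LHS]subr0 -gr /w /u; ring.
have hx : x ^+ 2 + u * x + w <= 0.
  by move: gx; rewrite gE nmulr_rge0 // subr_lt0; lra.
have hy : 0 < y ^+ 2 + u * y + w.
  by move: gy; rewrite gE nmulr_rlt0 // subr_lt0.
(* The chord slope of the quadratic from [x] to [y] is positive, so the slope [r + y + u] from [y]
   to [r] is too. The quadratic is thus positive at [r], which keeps [r] apart from its two
   roots. *)
have xyu : 0 < x + y + u.
  have -> : x + y + u =
    ((y ^+ 2 + u * y + w) - (x ^+ 2 + u * x + w)) / (y - x) by field; lra.
  by rewrite divr_gt0 //; lra.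
have hr : 0 < r ^+ 2 + u * r + w.
  have -> : r ^+ 2 + u * r + w =
    (y ^+ 2 + u * y + w) + (r - y) * (r + y + u) by ring.
  by rewrite addr_gt0 // mulr_gt0 //; lra.
pose e := u ^+ 2 - 4 * w.
have e_gt0 : 0 < e.
  have eE : e = (2 * x + u) ^+ 2 - 4 * (x ^+ 2 + u * x + w) by rewrite /e; ring.
  have s0 := sqr_ge0 (2 * x + u).
  rewrite lt_neqAle; apply/andP; split; last by lra.
  apply/eqP => e0.
  have h0 : x ^+ 2 + u * x + w = 0 by lra.
  have /eqP : (2 * x + u) ^+ 2 = 0 by lra.
  rewrite sqrf_eq0 => /eqP d0.
  have g0 : x ^+ 3 + p * x ^+ 2 + q * x + m = 0 by rewrite gE h0 mulr0.
  have /eqP[] := dg g0.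
  have -> : 3 * x ^+ 2 + 2 * p * x + q =
    (x ^+ 2 + u * x + w) + (x - r) * (2 * x + u) by rewrite /w /u; ring.
  by rewrite h0 d0 mulr0 addr0.
pose f := Num.sqrt e.
have f0 : 0 < f by rewrite sqrtr_gt0.
have fE : f ^+ 2 = e by rewrite sqr_sqrtr // ltW.
have q1 : ((- u + f) / 2) ^+ 2 + u * ((- u + f) / 2) + w = 0.
  have -> : ((- u + f) / 2) ^+ 2 + u * ((- u + f) / 2) + w =
    (f ^+ 2 - (u ^+ 2 - 4 * w)) / 4 by field.
  by rewrite fE subrr mul0r.
have q2 : ((- u - f) / 2) ^+ 2 + u * ((- u - f) / 2) + w = 0.
  have -> : ((- u - f) / 2) ^+ 2 + u * ((- u - f) / 2) + w =
    (f ^+ 2 - (u ^+ 2 - 4 * w)) / 4 by field.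
  by rewrite fE subrr mul0r.
exists r, ((- u + f) / 2), ((- u - f) / 2).
split; rewrite ?gE ?subrr ?mul0r ?q1 ?q2 ?mulr0 //.
rewrite /= !inE negb_or andbT -andbA; apply/and3P; split; apply/eqP.
- by move=> E; move: hr; rewrite E q1 ltxx.
- by move=> E; move: hr; rewrite E q2 ltxx.
- by move=> E; lra.
Qed.

(** * The normalized area cubic *)

Definition area_cubic (R : rcfType) (A C s t z : R) : R :=
  z ^+ 3 - 4 * (s * t) * z ^+ 2
  + (3 * A * s ^+ 2 + 3 * C * t ^+ 2 - A * C) * z - 2 * A * C * s * t.

Lemma area_cubic_roots_of_drop (R : rcfType) (A C s t x y : R) :
  x < y -> 0 <= area_cubic A C s t x -> area_cubic A C s t y < 0 ->
  (area_cubic A C s t x = 0 ->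
    3 * x ^+ 2 - 8 * (s * t) * x
    + (3 * A * s ^+ 2 + 3 * C * t ^+ 2 - A * C) != 0) ->
  exists r1 r2 r3, [/\ uniq [:: r1; r2; r3], area_cubic A C s t r1 = 0,
    area_cubic A C s t r2 = 0 & area_cubic A C s t r3 = 0].
Proof.
move=> xy gx gy dg.
have gE z : z ^+ 3 + (- (4 * (s * t))) * z ^+ 2
    + (3 * A * s ^+ 2 + 3 * C * t ^+ 2 - A * C) * z + (- (2 * A * C * s * t))
    = area_cubic A C s t z by rewrite /area_cubic; ring.
have [||| r1 [r2 [r3]]] := monic_cubic_roots (p := - (4 * (s * t)))
  (q := 3 * A * s ^+ 2 + 3 * C * t ^+ 2 - A * C)
  (m := - (2 * A * C * s * t)) xy.
- by rewrite gE.
- by rewrite gE.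
- rewrite gE => /dg; apply: contra => /eqP E; apply/eqP; rewrite -[RHS]E; ring.
by rewrite !gE => H; exists r1, r2, r3.
Qed.

Lemma area_cubic_roots_pos (R : rcfType) (A C s t : R) :
  0 < A * C -> C < s ^+ 2 -> A < t ^+ 2 -> 0 < s * t ->
  exists r1 r2 r3, [/\ uniq [:: r1; r2; r3], area_cubic A C s t r1 = 0,
    area_cubic A C s t r2 = 0 & area_cubic A C s t r3 = 0].
Proof.
move=> AC0 Cs At st0.
have [A0|A0|A0] := ltgtP A 0; last by move: AC0; rewrite A0 mul0r ltxx.
  have C0 : C < 0 by move: AC0; rewrite nmulr_rgt0.
  pose p := Num.sqrt (- A); pose q := Num.sqrt (- C).
  have p0 : 0 < p by rewrite sqrtr_gt0 oppr_gt0.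
  have q0 : 0 < q by rewrite sqrtr_gt0 oppr_gt0.
  have pE : A = - p ^+ 2 by rewrite sqr_sqrtr ?opprK // oppr_ge0 ltW.
  have qE : C = - q ^+ 2 by rewrite sqr_sqrtr ?opprK // oppr_ge0 ltW.
  have pq0 : 0 < p * q by apply: mulr_gt0.
  (* Here [p * q] is the square root of [A * C], so [- (p * q)] is an end of the interval of those B
     that give ellipses. *)
  have gk : area_cubic A C s t (- (p * q)) = 3 * (p * q) * (p * s - q * t) ^+ 2.
    by rewrite /area_cubic pE qE; ring.
  apply: (@area_cubic_roots_of_drop _ _ _ _ _ (- (p * q)) 0).
  - by rewrite oppr_lt0.
  - by rewrite gk mulr_ge0 ?sqr_ge0 //; lra.
  - have -> : area_cubic A C s t 0 = - (2 * ((A * C) * (s * t))).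
      by rewrite /area_cubic; ring.
    by rewrite oppr_lt0 pmulr_rgt0 // mulr_gt0.
  (* A zero at the left end forces [p * s = q * t]; with k = [p * q] the derivative there is 2k(k +
     st) > 0. *)
  - rewrite gk => /eqP; rewrite !mulf_eq0 (gt_eqF p0) (gt_eqF q0) pnatr_eq0 /=.
    rewrite orbb => /eqP ps; apply: lt0r_neq0.
    have -> : 3 * (- (p * q)) ^+ 2 - 8 * (s * t) * (- (p * q))
      + (3 * A * s ^+ 2 + 3 * C * t ^+ 2 - A * C) =
      2 * ((p * q) * (p * q)) + 2 * ((s * t) * (p * q)) - 3 * (p * s - q * t) ^+ 2.
      by rewrite pE qE; ring.
    rewrite ps expr0n /= mulr0 subr0.
    by apply: addr_gt0; rewrite pmulr_rgt0 // mulr_gt0.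
have C0 : 0 < C by move: AC0; rewrite pmulr_rgt0.
pose p := Num.sqrt A; pose q := Num.sqrt C.
have p0 : 0 < p by rewrite sqrtr_gt0.
have q0 : 0 < q by rewrite sqrtr_gt0.
have pE : A = p ^+ 2 by rewrite sqr_sqrtr // ltW.
have qE : C = q ^+ 2 by rewrite sqr_sqrtr // ltW.
have pq0 : 0 < p * q by apply: mulr_gt0.
(* After squaring, this is the product of the hypotheses [C < s ^+ 2] and [A < t ^+ 2], all terms
   being positive here. *)
have pq_st : p * q < s * t.
  rewrite -(ltr_pXn2r (n := 2)) ?nnegrE ?ltW //.
  rewrite !exprMn -pE -qE mulrC; apply: ltr_pM => //; exact: ltW.
have gk : area_cubic A C s t (p * q) = 3 * (p * q) * (p * s - q * t) ^+ 2.
  by rewrite /area_cubic pE qE; ring.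
apply: (area_cubic_roots_of_drop pq_st).
- by rewrite gk mulr_ge0 ?sqr_ge0 //; lra.
- have -> : area_cubic A C s t (s * t) =
    - (3 * ((s * t) * ((s ^+ 2 - C) * (t ^+ 2 - A)))).
    by rewrite /area_cubic; ring.
  by rewrite oppr_lt0 pmulr_rgt0 // !(mulr_gt0 st0, mulr_gt0) ?subr_gt0.
(* Again [p * s = q * t], but the derivative at k is now -2k(st - k) < 0. *)
- rewrite gk => /eqP; rewrite !mulf_eq0 (gt_eqF p0) (gt_eqF q0) pnatr_eq0 /=.
  rewrite orbb => /eqP ps; apply: ltr0_neq0.
  have -> : 3 * (p * q) ^+ 2 - 8 * (s * t) * (p * q)
    + (3 * A * s ^+ 2 + 3 * C * t ^+ 2 - A * C) =
    - (2 * ((p * q) * (s * t - p * q))) + 3 * (p * s - q * t) ^+ 2.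
    by rewrite pE qE; ring.
  rewrite ps expr0n /= mulr0 addr0 oppr_lt0.
  by rewrite pmulr_rgt0 // mulr_gt0 ?subr_gt0.
Qed.

Lemma area_cubic_roots (R : rcfType) (A C s t : R) :
  0 < A * C -> C < s ^+ 2 -> A < t ^+ 2 ->
  exists r1 r2 r3, [/\ uniq [:: r1; r2; r3], area_cubic A C s t r1 = 0,
    area_cubic A C s t r2 = 0 & area_cubic A C s t r3 = 0].
Proof.
move=> AC0 Cs At; have [st0|st0|st0] := ltgtP (s * t) 0.
- have [|||| r1 [r2 [r3 [ru h1 h2 h3]]]] :=
    @area_cubic_roots_pos _ A C (- s) t => //.
  + by rewrite sqrrN.
  + by rewrite mulNr oppr_gt0.
  (* Reflecting the plane in the second axis changes the signs of [s] and B together, which reduces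
     [s * t < 0] to [s * t > 0]. *)
  have gN z : area_cubic A C s t (- z) = - area_cubic A C (- s) t z.
    by rewrite /area_cubic; ring.
  exists (- r1), (- r2), (- r3).
  rewrite !gN h1 h2 h3 oppr0; split => //.
  by rewrite -(map_inj_uniq oppr_inj) in ru.
- exact: area_cubic_roots_pos.
(* When [s * t = 0] the cubic is odd, z(z^2 - e). Positive [A] and [C] would make [s] and [t]
   nonzero, so both are negative and [e > 0]. *)
pose e := A * C - 3 * A * s ^+ 2 - 3 * C * t ^+ 2.
have AC_neg : A < 0 /\ C < 0.
  have [A0|A0|A0] := ltgtP A 0; last by move: AC0; rewrite A0 mul0r ltxx.
    by split=> //; move: AC0; rewrite nmulr_rgt0.
  have C0 : 0 < C by move: AC0; rewrite pmulr_rgt0.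
  have : 0 < (s * t) ^+ 2 by rewrite exprMn mulr_gt0 //; lra.
  by rewrite st0 expr0n ltxx.
case: AC_neg => A0 C0.
have e0 : 0 < e.
  have h1 : A * s ^+ 2 <= 0 by rewrite mulr_le0_ge0 ?sqr_ge0 ?ltW.
  have h2 : C * t ^+ 2 <= 0 by rewrite mulr_le0_ge0 ?sqr_ge0 ?ltW.
  rewrite /e; lra.
pose f := Num.sqrt e.
have f0 : 0 < f by rewrite sqrtr_gt0.
have fE : f ^+ 2 = e by rewrite sqr_sqrtr // ltW.
have gE z : area_cubic A C s t z = z * (z ^+ 2 - e).
  have -> : area_cubic A C s t z =
    z * (z ^+ 2 - e) - (s * t) * (4 * z ^+ 2 + 2 * A * C).
    by rewrite /area_cubic /e; ring.
  by rewrite st0 mul0r subr0.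
exists 0, f, (- f); rewrite !gE sqrrN fE subrr !mulr0 mul0r; split => //.
rewrite /= !inE negb_or andbT -andbA; apply/and3P.
by split; apply/eqP => E; lra.
Qed.

(** * Ellipses meeting both coordinate axes *)

Lemma ellipse_axis_product_gt0 (R : realType) (S : set (R * R)) (a b c d : R) :
  uniq [:: (a, 0); (b, 0); (0, c); (0, d)] -> is_ellipse S ->
  S (a, 0) -> S (b, 0) -> S (0, c) -> S (0, d) -> 0 < (c * d) * (a * b).
Proof.
move=> + [[o1 o2] [u [v [p [q [uv p0 q0 ->]]]]]].
rewrite /ellipse_locus /= !inE !xpair_eqE !eqxx ?andbT ?andTb !negb_or.
move=> /and3P[/and3P[ab ac ad] /andP[bc bd] cd].
set P := (p ^+ 2)^-1; set Q := (q ^+ 2)^-1.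
have P0 : 0 < P by rewrite invr_gt0 exprn_gt0.
have Q0 : 0 < Q by rewrite invr_gt0 exprn_gt0.
move=> Ea Eb Ec Ed.
(* Expanded, the ellipse equation has quadratic part [al] x^2 + 2 [be] xy + [ga] y^2 and constant
   term [ph]. Vieta on the two axes gives [al * (a * b) = ph = ga * (c * d)], so the desired product
   times [al * ga > 0] is [ph ^+ 2]. *)
pose al := u ^+ 2 * P + v ^+ 2 * Q.
pose be := u * v * (P - Q).
pose ga := v ^+ 2 * P + u ^+ 2 * Q.
have weighted_gt0 (x y : R) : x ^+ 2 + y ^+ 2 = 1 -> 0 < x ^+ 2 * P + y ^+ 2 * Q.
  move=> xy; have x0 := sqr_ge0 x; have y0 := sqr_ge0 y.
  have xP : 0 <= x ^+ 2 * P by rewrite mulr_ge0 // ltW.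
  have [x1|x1] := ltP 0 (x ^+ 2).
    by apply: ltr_pwDl; [rewrite mulr_gt0 | rewrite mulr_ge0 // ltW].
  by rewrite ltr_wpDl // mulr_gt0 //; lra.
have al0 : 0 < al by apply: weighted_gt0.
have ga0 : 0 < ga by apply: weighted_gt0; rewrite addrC.
pose ph := al * o1 ^+ 2 + 2 * be * o1 * o2 + ga * o2 ^+ 2 - 1.
have abE : al * (a * b) = ph.
  have xy0 : a - b != 0 by rewrite subr_eq0.
  apply: (mulfI xy0); apply/eqP; rewrite -subr_eq0; apply/eqP.
  (* The first two 1s are replaced by the equations at (a, 0) and (b, 0). Weighting these by [b] and
     [- a] cancels the linear term and leaves a multiple of [a - b]. *)
  transitivity (b * 1 - a * 1 - (b - a) : R); last by ring.
  by rewrite -{1}Ea -Eb /ph /al /be /ga; ring.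
have cdE : ga * (c * d) = ph.
  have xy0 : c - d != 0 by rewrite subr_eq0.
  apply: (mulfI xy0); apply/eqP; rewrite -subr_eq0; apply/eqP.
  transitivity (d * 1 - c * 1 - (d - c) : R); last by ring.
  by rewrite -{1}Ec -Ed /ph /al /be /ga; ring.
have ph0 : ph != 0.
  (* If [ph = 0], one of [a], [b] and one of [c], [d] vanish, so two of the four points coincide at
     the origin. *)
  apply/eqP => ph0; move: abE cdE; rewrite ph0 => /eqP + /eqP.
  rewrite !mulf_eq0 (gt_eqF al0) (gt_eqF ga0) /=.
  by move=> /orP[] /eqP x0 /orP[] /eqP y0; move: ac ad bc bd;
    rewrite x0 y0 eqxx.
have : 0 < (al * ga) * ((c * d) * (a * b)).
  have -> : (al * ga) * ((c * d) * (a * b)) = ph ^+ 2.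
    by rewrite expr2 -{1}abE -cdE; ring.
  by rewrite exprn_even_gt0.
by rewrite pmulr_rgt0 // mulr_gt0.
Qed.

Theorem mainTheorem1 (R : realType) (a b c d : R)
  (points_distinct : uniq [:: (a, 0); (b, 0); (0, c); (0, d)])
  (ellipse_through : exists S : set (R * R),
     is_ellipse S /\ [/\ S (a, 0), S (b, 0), S (0, c) & S (0, d)]) :
  let A := c * d in
  let C := a * b in
  let D := - (1 / 2) * (c * d) * (a + b) in
  let E := - (1 / 2) * (a * b) * (c + d) in
  let F := a * b * c * d in
  let f : {poly R} :=
    F *: 'X^3 - (4 * D * E) *: 'X^2
    + (3 * C * D ^+ 2 + 3 * A * E ^+ 2 - A * C * F) *: 'X
    - (2 * A * C * D * E)%:P in
  size f = 4%N /\
  exists B1 B2 B3 : R,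
    [/\ uniq [:: B1; B2; B3], root f B1, root f B2 & root f B3].
Proof.
move=> A C D E F f.
have [S [ellS [Sa Sb Sc Sd]]] := ellipse_through.
have AC0 := ellipse_axis_product_gt0 points_distinct ellS Sa Sb Sc Sd.
have [ab cd] : a != b /\ c != d.
  move: points_distinct; rewrite /= !inE !xpair_eqE !eqxx ?andbT ?andTb !negb_or.
  by move=> /and3P[/and3P[]].
have mean_sqr (x y : R) : x != y -> x * y < ((x + y) / 2) ^+ 2.
  move=> xy; rewrite -subr_gt0.
  have -> : ((x + y) / 2) ^+ 2 - x * y = ((x - y) / 2) ^+ 2 by field.
  by rewrite exprn_even_gt0 //= mulf_neq0 ?subr_eq0 // invr_eq0 pnatr_eq0.
have [r1 [r2 [r3 [ru h1 h2 h3]]]] :=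
  area_cubic_roots AC0 (mean_sqr _ _ ab) (mean_sqr _ _ cd).
have F0 : F != 0 by rewrite /F -mulrA mulrC; apply: lt0r_neq0.
(* With [s] and [t] the half-sums, D = -As, E = -Ct and F = AC, so every coefficient of [f] is
   divisible by [F]. *)
have fE z : f.[z] = F * area_cubic (c * d) (a * b) ((a + b) / 2) ((c + d) / 2) z.
  rewrite /f !(hornerD, hornerN, hornerZ, hornerXn, hornerX, hornerC).
  by rewrite /area_cubic /F /E /D /A /C; field.
split; last first.
  by exists r1, r2, r3; rewrite /root !fE h1 h2 h3 mulr0 eqxx; split.
(* As [F] is nonzero, the cubic term fixes the size once the remaining terms are bounded below size
   4. *)
rewrite /f -!addrA size_polyDl size_scale // size_polyXn //.
apply: (leq_ltn_trans (size_polyD _ _)); rewrite gtn_max size_polyN.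
rewrite (leq_ltn_trans (size_scale_leq _ _)) ?size_polyXn //=.
apply: (leq_ltn_trans (size_polyD _ _)); rewrite gtn_max size_polyN.
rewrite (leq_ltn_trans (size_scale_leq _ _)) ?size_polyX //=.
by rewrite (leq_ltn_trans (size_polyC_leq1 _)).
Qed.
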